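(* Let $d\ge 2$, let $M_{c^*}:\mathbb{R}^d\to\mathbb{R}$ be an affine function (the margin of a linear classification model, as defined in the context) with $\nabla M_{c^*}\neq 0$, and let $z\in\mathbb{R}^d$ satisfy $M_{c^*}(z)>0$. Fix $\delta\in(0,1)$ and, for a radius $R>0$, let $$\mathbb{E}\big[\widehat{\nabla M_{c^*}}(z,R)\big]:=\mathbb{E}_u\big[\Phi_{c^*}(z+\delta R u)\,u\big],$$ where $u$ is uniformly distributed on the unit sphere of $\mathbb{R}^d$. Then $$\cos\angle\Big(\mathbb{E}\big[\widehat{\nabla M_{c^*}}(z,R)\big],\ \nabla M_{c^*}(z)\Big)\ \ge\ 1-\mathcal{O}\!\left(\frac{M_{c^*}(z)^2\,(d-1)^2}{\delta^2R^2\,\|\nabla M_{c^*}(z)\|_2^2}\right),$$ and consequently $$\lim_{R\to\infty}\cos\angle\Big(\mathbb{E}\big[\widehat{\nabla M_{c^*}}(z,R)\big],\ \nabla M_{c^*}(z)\Big)=1.$$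
   Context: A classifier $f$ has class scores $f_c$ for $c$ in a finite label set $C$, and $c^*\in C$ is a target class. The margin is $M_{c^*}(z)=f_{c^*}(z)-\max_{c\neq c^*}f_c(z)$ (in the paper $z$ is a latent vector fed through a generator; here $M_{c^*}$ is regarded directly as a function of $z\in\mathbb{R}^d$). ''Linear classification model'' means $M_{c^*}$ is affine in $z$, so its first-order Taylor expansion is exact. $\mathrm{sign}(t)=1$ if $t>0$ and $-1$ otherwise, and $\Phi_{c^*}(z)=(\mathrm{sign}(M_{c^*}(z))-1)/2$, i.e. $\Phi_{c^*}(z)=0$ if $z$ is classified as $c^*$ ($M_{c^*}(z)>0$) and $-1$ otherwise. The label-only gradient estimator is $\widehat{M_{c^*}}(z,R)=\frac1N\sum_{n=1}^N\Phi_{c^*}(z+Ru_n)u_n$ with $u_n$ sampled uniformly on a sphere; its expectation is the quantity in the claim. $\angle(a,b)$ is the angle between vectors $a,b$. The $\mathcal{O}$ is as $R$ varies with $z$, $d$, $\delta$ and $M_{c^*}$ fixed. *)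

(* Defs.v *)
From HB Require Import structures.
From mathcomp Require Import all_boot all_order all_algebra.
From mathcomp Require Import all_classical all_reals all_analysis.
Set Implicit Arguments. Unset Strict Implicit. Unset Printing Implicit Defensive.
Import Order.TTheory GRing.Theory Num.Theory.
Import numFieldNormedType.Exports.
Local Open Scope ring_scope.

Section Defs.
Variable R : realType.

Definition dotp (d : nat) (u v : 'rV[R]_d) : R := \sum_(i < d) u ord0 i * v ord0 i.
Definition enorm (d : nat) (v : 'rV[R]_d) : R := Num.sqrt (dotp v v).

Definition cos_angle (d : nat) (u v : 'rV[R]_d) : R :=
  dotp u v / (enorm u * enorm v).

Definition sgn (t : R) : R := if 0 < t then 1 else -1.

Definition Phi (d : nat) (M : 'rV[R]_d -> R) (x : 'rV[R]_d) : R :=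
  (sgn (M x) - 1) / 2.

(* d-dimensional Lebesgue integral, computed as an iterated integral of
   one-dimensional Lebesgue integrals (Fubini) *)
Fixpoint iter_int (n : nat) (F : seq R -> R) : R :=
  match n with
  | 0 => F [::]
  | n'.+1 => Rintegral (@lebesgue_measure R) setT
               (fun t : R => iter_int n' (fun s => F (t :: s)))
  end.

Definition integral_Rd (d : nat) (f : 'rV[R]_d -> R) : R :=
  iter_int d (fun s => f (\row_(i < d) nth 0 s i)).

Definition unit_ball_ind (d : nat) (x : 'rV[R]_d) : R :=
  if (0 < enorm x) && (enorm x <= 1) then 1 else 0.

(* Expectation of g(u) for u uniformly distributed on the unit sphere
   S^{d-1}: the normalized surface measure on the sphere is the
   normalized cone measure  sigma(A) = vol{ r u | 0 < r <= 1, u in A } / vol(B),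
   so E_u[g u] = (1/vol B) * int_B g(x/|x|) dx. *)
Definition sphere_expect (d : nat) (g : 'rV[R]_d -> R) : R :=
  integral_Rd (fun x => unit_ball_ind x * g ((enorm x)^-1 *: x))
  / integral_Rd (@unit_ball_ind d).

Definition sphere_expect_vec (d : nat) (g : 'rV[R]_d -> R) : 'rV[R]_d :=
  \row_(i < d) sphere_expect (fun u => g u * u ord0 i).

Definition expected_grad_est (d : nat) (M : 'rV[R]_d -> R)
    (z : 'rV[R]_d) (delta rad : R) : 'rV[R]_d :=
  sphere_expect_vec (fun u => Phi M (z + (delta * rad) *: u)).

End Defs.

(* Main.v *)
Require Import Defs.
From HB Require Import structures.
From mathcomp Require Import all_boot all_order all_algebra.
From mathcomp Require Import all_classical all_reals all_analysis.
From mathcomp Require Import measurable_realfun zify ring lra.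
Import Order.TTheory GRing.Theory Num.Theory.
Import numFieldNormedType.Exports.
Set Implicit Arguments. Unset Strict Implicit. Unset Printing Implicit Defensive.
Local Open Scope classical_set_scope.
Local Open Scope ring_scope.

(** For an affine margin, [Phi] at [z + delta R u] depends on [u] only through
    [a . u], so the expected estimator is invariant under every reflection fixing
    the gradient [a] and is therefore a multiple of [a]. It pairs positively with
    [a] as soon as the half-space [M <= 0] cuts the sphere of radius [delta R] in
    a cap of positive measure, so the cosine is exactly [1] for all large [R] and
    the constant of the O-term may be taken to be [0].

    Only reflections acting on two coordinates are needed: if [a_j = r a_i], the
    one fixing [(1, r)] is a product of three maps each changing one coordinate,
    and these preserve an iterated Lebesgue integral because, by Fubini, the
    changed coordinate can be integrated first. *)

(** * Lebesgue measure on the line: Fubini on a box and affine changes of variable *)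

Section Lebesgue1D.
Variable R : realType.
Local Notation mu := (@lebesgue_measure R).
Local Notation TR := (measurableTypeR R).

(** Uniqueness of Lebesgue measure: the push-forward under a translation still gives []a, b]] its
    length. *)
Lemma lebesgue_measureD (c : R) (A : set R) : measurable A ->
  pushforward mu ((fun t => t + c) : _ -> TR) A = mu A.
Proof.
move=> mA.
have mc : measurable_fun setT ((fun t => t + c) : TR -> TR) by apply: measurable_funD.
apply/esym/(lebesgue_measure_unique
  (mu := pushforward mu ((fun t => t + c) : TR -> TR))) => //= _ [[a b]] _ <-.
have -> : (pushforward mu ((fun t => t + c) : TR -> TR)) [set` `]a, b]]
    = mu `]a - c, b - c].
  congr (mu _); apply/seteqP; split => x /=; rewrite !in_itv/=; lra.
rewrite !lebesgue_measure_itv/= !lte_fin.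
rewrite ltrD2r; case: ifP => // _.
by rewrite -!EFinB; congr (_%:E); ring.
Qed.

(** The boolean multiplies [K] by 0 or 1, so one inequality records both the bound [K] and the
    support in [[-B, B]]. *)
Lemma box_integrable (K B : R) (g : R -> R) :
  measurable_fun setT (g : TR -> TR) -> (forall t, `|g t| <= K *+ (`|t| <= B)%R) ->
  mu.-integrable setT (EFin \o g).
Proof.
move=> mg gK.
apply: (@le_integrable _ _ _ mu _ measurableT _
  (EFin \o (fun t => K * \1_(`[-B, B]%classic) t))).
- exact/measurable_EFinP.
- move=> t _ /=; rewrite lee_fin (le_trans (gK t))//.
  rewrite indicE mem_setE in_itv/= -ler_norml; case: (`|t| <= B) => /=.
    by rewrite mulr1 ler_norm.
  by rewrite mulr0 normr0 mulr0n.
- under [X in _.-integrable _ X]eq_fun do rewrite /= EFinM.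
  by apply: integrableZl => //; exact: integrable_indic_itv.
Qed.

Lemma fubini_box (K B : R) (H : R * R -> R) :
  measurable_fun setT (H : TR * TR -> TR) ->
  (forall p, `|H p| <= K *+ ((`|p.1| <= B) && (`|p.2| <= B))%R) ->
  Rintegral mu setT (fun x => Rintegral mu setT (fun y => H (x, y))) =
  Rintegral mu setT (fun y => Rintegral mu setT (fun x => H (x, y))).
Proof.
move=> mH HK.
pose A : set TR := `[-B, B]%classic.
have mA : measurable A by exact: measurable_itv.
have muA : (mu A < +oo)%E.
  by rewrite lebesgue_measure_itv/=; case: ifP => _; rewrite ltry.
have intH : (mu \x mu)%E.-integrable setT (EFin \o H).
  apply: (@le_integrable _ _ _ (mu \x mu)%E _ measurableT _
    (EFin \o (fun t => K * \1_(A `*` A) t))).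
  - exact/measurable_EFinP.
  - move=> t _ /=; rewrite lee_fin (le_trans (HK t))//.
    rewrite indicE in_setX !mem_setE !in_itv/= -!ler_norml; case: (_ && _) => /=.
      by rewrite mulr1 ler_norm.
    by rewrite mulr0 normr0 mulr0n.
  - under [X in _.-integrable _ X]eq_fun do rewrite /= EFinM.
    have mAA := measurableX mA mA.
    apply: integrableZl => //; apply/integrableP; split.
      exact/measurable_EFinP.
    rewrite (eq_integral (EFin \o \1_(A `*` A))); last first.
      by move=> t _; rewrite gee0_abs// lee_fin.
    rewrite integral_indic// setIT; have /= -> := product_measure1E mu mu mA mA.
    rewrite lte_mul_pinfty// ge0_fin_numE//.
(* The inner integrals are finite, so they may be read as extended reals, where [Fubini] applies. *)
have fin1 x : (Rintegral mu setT (fun y => H (x, y)))%:E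
    = (\int[mu]_y (EFin \o H) (x, y))%E.
  rewrite /Rintegral fineK//; apply: integrable_fin_num => //.
  (* The absolute value covers [x] outside the box: the bound there is 0 and [K] has no assumed
     sign. *)
  apply: (@box_integrable `|K| B (fun y => H (x, y))).
    exact: measurableT_comp.
  move=> t; apply: (le_trans (HK (x, t))) => /=.
  case: (`|x| <= B); case: (`|t| <= B) => //=;
    by rewrite ?mulr0n ?mulr1n ?normr_ge0 ?ler_norm.
have fin2 y : (Rintegral mu setT (fun x => H (x, y)))%:E
    = (\int[mu]_x (EFin \o H) (x, y))%E.
  rewrite /Rintegral fineK//; apply: integrable_fin_num => //.
  apply: (@box_integrable `|K| B (fun x => H (x, y))).
    exact: measurableT_comp.
  move=> t; apply: (le_trans (HK (t, y))) => /=.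
  case: (`|y| <= B); case: (`|t| <= B) => //=;
    by rewrite ?mulr0n ?mulr1n ?normr_ge0 ?ler_norm.
rewrite /Rintegral; congr fine.
under eq_integral do rewrite fin1.
under [in RHS]eq_integral do rewrite fin2.
exact: Fubini.
Qed.

(** [B *+ 2] is the length of the supporting interval. *)
Lemma norm_Rintegral_box (K B : R) (g : R -> R) :
  0 <= B -> measurable_fun setT (g : TR -> TR) ->
  (forall t, `|g t| <= K *+ (`|t| <= B)%R) ->
  `|Rintegral mu setT g| <= K * (B *+ 2).
Proof.
move=> B0 mg gK.
apply: (le_trans (le_normr_Rintegral measurableT (box_integrable mg gK))).
have -> : K * (B *+ 2) = Rintegral mu setT (fun t => K * \1_(`[-B, B]%classic) t).
  rewrite RintegralZl//; last exact: integrable_indic_itv.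
  rewrite /Rintegral integral_indic// setIT.
  have /= := lebesgue_measure_itv `[-B, B] => ->; rewrite lte_fin.
  case: ltP => [_|]; first by rewrite -EFinB /= opprK mulr2n.
  move=> BB; have -> : B = 0 by lra.
  by rewrite mul0rn.
have gK' t : `|g t| <= K * \1_(`[-B, B]%classic) t.
  rewrite (le_trans (gK t))//.
  rewrite indicE mem_setE in_itv/= -ler_norml; case: (`|t| <= B) => /=.
    by rewrite mulr1.
  by rewrite mulr0 mulr0n.
apply: le_Rintegral => //.
- apply: integrable_norm => //; exact: (box_integrable mg gK).
- apply: (@box_integrable `|K| B) => //.
    by apply: measurable_funM.
  move=> t; rewrite indicE mem_setE in_itv/= -ler_norml; case: (`|t| <= B) => /=.
    by rewrite mulr1.
  by rewrite mulr0 mulr0n normr0.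
Qed.

(** Since [eps] is a sign, the Jacobian has modulus 1. Translations are treated first, by
    push-forward; the case [eps = -1] follows by a further negation. *)
Lemma Rintegral_affine_var (K B eps c : R) (g : R -> R) :
  eps = 1 \/ eps = -1 -> measurable_fun setT (g : TR -> TR) ->
  (forall t, `|g t| <= K *+ (`|t| <= B)%R) ->
  Rintegral mu setT (fun t => g (eps * t + c)) = Rintegral mu setT g.
Proof.
move=> eps1 mg gK.
(* The preimage of the interval of radius [B] lies in the one of radius [B + |d|]. *)
have gK' e d : e = 1 \/ e = -1 -> forall t,
    `|g (e * t + d)| <= `|K| *+ (`|t| <= B + `|d|)%R.
  move=> e1 t; apply: (le_trans (gK _)).
  have [tB|_] := leP `|e * t + d| B; last by rewrite mulr0n mulrn_wge0.
  have -> : `|t| <= B + `|d|.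
    have := ler_normB (e * t + d) d; rewrite addrK.
    by move: tB; case: e1 => ->; rewrite ?mul1r ?mulN1r ?normrN; lra.
  by rewrite !mulr1n ler_norm.
have mgd e d : measurable_fun setT ((fun t => g (e * t + d)) : TR -> TR).
  by apply: measurableT_comp => //; apply: measurable_funD.
have shift : Rintegral mu setT (fun t => g (1 * t + c)) = Rintegral mu setT g.
  have mc : measurable_fun setT ((fun t => t + c) : TR -> TR) by exact: measurable_funD.
  rewrite [RHS]/Rintegral
    (eq_measure_integral (pushforward mu ((fun t => t + c) : TR -> TR))); last first.
    by move=> A mA _; apply/esym; exact: lebesgue_measureD.
  rewrite integral_pushforward//=.
  - by rewrite preimage_setT; congr fine; apply: eq_integral => t _; rewrite mul1r.
  - exact/measurable_EFinP.
  - rewrite preimage_setT.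
    apply: eq_integrable (box_integrable (mgd 1 c) (gK' 1 c (or_introl erefl))) => //.
    by move=> t _ /=; rewrite mul1r.
case: eps1 => ->; first exact: shift.
rewrite -shift.
rewrite [RHS]/Rintegral
    (eq_measure_integral (pushforward mu (-%R : TR -> TR))); last first.
  by move=> A mA _; apply/esym; exact: lebesgue_measureN.
rewrite integral_pushforward//=.
- by rewrite preimage_setT; congr fine; apply: eq_integral => t _ /=;
    rewrite mul1r mulN1r.
- apply/measurable_EFinP; exact: (mgd 1 c).
- rewrite preimage_setT.
  apply: eq_integrable (box_integrable (mgd (-1) c) (gK' (-1) c (or_intror erefl))) => //.
  by move=> t _ /=; rewrite mul1r mulN1r.
Qed.

End Lebesgue1D.

(** * Iterated integrals over finite sequences, and the order of integration *)

Section IteratedIntegral.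
Variable R : realType.
Local Notation mu := (@lebesgue_measure R).
Local Notation TR := (measurableTypeR R).
Implicit Types (n : nat) (F G : seq R -> R) (s : seq R).

(* Testing against all measurable parametrizations gives joint measurability in the
   [n] coordinates without a sigma-algebra on sequences, and composes trivially. *)
Definition seq_measurable n F := forall d (X : measurableType d) (phi : nat -> X -> R),
  (forall i, measurable_fun setT (phi i : X -> TR)) ->
  measurable_fun setT ((fun x => F (mkseq (phi^~ x) n)) : X -> TR).

Definition box_bounded n F := exists K B : R, [/\ 0 <= K, 0 <= B &
  forall s, size s = n -> `|F s| <= K *+ all (fun t => `|t| <= B)%R s].

(** A class stable under sections and under integrating out a coordinate, so that inductions on [n]
    stay inside it and all integrals are finite. *)
Definition seq_integrand n F := seq_measurable n F /\ box_bounded n F.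

Definition insert_at (i : nat) (t : R) s := take i s ++ t :: drop i s.

Lemma size_insert_at i t s : size (insert_at i t s) = (size s).+1.
Proof. by rewrite /insert_at size_cat /= addnS -size_cat cat_take_drop. Qed.

Lemma all_insert_at (a : pred R) i t s : all a (insert_at i t s) = a t && all a s.
Proof.
by rewrite /insert_at all_cat /= andbCA -all_cat cat_take_drop.
Qed.

(** [unbump i] undoes the shift by one of the indices beyond the inserted entry. *)
Lemma nth_insert_at i t s k : (i <= size s)%N ->
  nth 0 (insert_at i t s) k = if k == i then t else nth 0 s (unbump i k).
Proof.
move=> si; rewrite /insert_at nth_cat size_takel// /unbump.
case: ltngtP => ki.
- by rewrite nth_take// subn0.
- by rewrite -[(k - i)%N]prednK ?subn_gt0//= nth_drop subn1; congr nth; lia.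
- by rewrite ki subnn.
Qed.

Lemma insert_at_mkseq n i t (f : nat -> R) : (i <= n)%N ->
  insert_at i t (mkseq f n) = mkseq (fun k => if k == i then t else f (unbump i k)) n.+1.
Proof.
move=> si; apply: (@eq_from_nth _ 0); first by rewrite size_insert_at !size_mkseq.
move=> k; rewrite size_insert_at size_mkseq => kn.
rewrite [RHS]nth_mkseq// nth_insert_at ?size_mkseq//; case: (k =P i) => // /eqP ki.
by rewrite nth_mkseq// /unbump; move: ki; case: (ltngtP i k) => //= ik _; lia.
Qed.

Lemma seq_integrand_section n F i t : (i <= n)%N ->
  seq_integrand n.+1 F -> seq_integrand n (fun s => F (insert_at i t s)).
Proof.
move=> ni [mF [K [B [K0 B0 FK]]]]; split.
- move=> d X phi mphi; under eq_fun do rewrite insert_at_mkseq//.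
  (* The section uses a parametrization that is constant in coordinate [i]. *)
  apply: (mF _ _ (fun k x => if k == i then t else phi (unbump i k) x)) => k.
  by case: (k =P i).
- exists K, B; split=> // s sn; have := FK (insert_at i t s).
  rewrite size_insert_at sn => /(_ erefl) /le_trans; apply.
  by rewrite all_insert_at; case: (`|t| <= B)%R => //=; rewrite mulr0n mulrn_wge0.
Qed.

Lemma seq_integrand_line n F i s : (i <= n)%N -> size s = n -> seq_integrand n.+1 F ->
  measurable_fun setT ((fun t => F (insert_at i t s)) : TR -> TR) /\
  exists K B : R, [/\ 0 <= K, 0 <= B &
    forall t, `|F (insert_at i t s)|
      <= (K *+ all (fun t => `|t| <= B)%R s) *+ (`|t| <= B)%R].
Proof.
move=> ni sn [mF [K [B [K0 B0 FK]]]]; split.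
- rewrite -(mkseq_nth 0 s) sn; under eq_fun do rewrite insert_at_mkseq//.
  (* Here the parameter space is the line itself, and only coordinate [i] moves. *)
  apply: (mF _ TR (fun k x => if k == i then x else nth 0 s (unbump i k))) => k.
  by case: (k =P i).
- exists K, B; split=> // t; have := FK (insert_at i t s).
  rewrite size_insert_at sn => /(_ erefl) /le_trans; apply.
  by rewrite all_insert_at -mulrnA mulnb andbC.
Qed.

Definition int_at i F s := Rintegral mu setT (fun t => F (insert_at i t s)).

(** Positive and negative parts are separated, and the measurability half of Tonelli's theorem
    applies to each. *)
Lemma measurable_Rintegral_param d (X : measurableType d) (H : X * R -> R) :
  measurable_fun setT (H : X * TR -> TR) ->
  measurable_fun setT ((fun x => Rintegral mu setT (fun t => H (x, t))) : X -> TR).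
Proof.
move=> mH; rewrite /Rintegral.
under eq_fun do rewrite integralE.
apply: measurableT_comp => //; apply: emeasurable_funB.
- rewrite (_ : (fun x => _) = fubini_F mu (EFin \o H)^\+%E); last first.
    by apply/funext => x; apply: eq_integral => t _; rewrite /= !funeposE.
  apply: measurable_fun_fubini_tonelli_F => //.
  by apply: measurable_funepos; exact/measurable_EFinP.
- rewrite (_ : (fun x => _) = fubini_F mu (EFin \o H)^\-%E); last first.
    by apply/funext => x; apply: eq_integral => t _; rewrite /= !funenegE.
  apply: measurable_fun_fubini_tonelli_F => //.
  by apply: measurable_funeneg; exact/measurable_EFinP.
Qed.

Lemma seq_integrand_int_at n F i : (i <= n)%N ->
  seq_integrand n.+1 F -> seq_integrand n (int_at i F).
Proof.
move=> ni nF; have [mF [K [B [K0 B0 FK]]]] := nF; split.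
- move=> d X phi mphi; rewrite /int_at.
  under eq_fun do under eq_Rintegral do rewrite insert_at_mkseq//.
  (* The integration variable becomes the second component of an enlarged parameter space. *)
  apply: (measurable_Rintegral_param (H := fun p =>
    F (mkseq (fun k => if k == i then p.2 else phi (unbump i k) p.1) n.+1))).
  apply: (mF _ _ (fun k (p : X * TR) =>
    if k == i then p.2 else phi (unbump i k) p.1)) => k.
  by case: (k =P i) => // _; exact: measurableT_comp.
- exists (K * (B *+ 2)), B; split => //; first by rewrite mulr_ge0// mulrn_wge0.
  move=> s sn; rewrite -mulrnAl; apply: norm_Rintegral_box => //.
    by have [] := seq_integrand_line ni sn nF.
  move=> t; have := FK (insert_at i t s).
  rewrite size_insert_at sn => /(_ erefl) /le_trans; apply.
  by rewrite all_insert_at -mulrnA mulnb andbC.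
Qed.

Lemma eq_iter_int n F G : (forall s, size s = n -> F s = G s) ->
  iter_int n F = iter_int n G.
Proof.
elim: n F G => [|n IH] F G FG /=; first exact: FG.
by apply: eq_Rintegral => t _; apply: IH => s sn; apply: FG; rewrite /= sn.
Qed.

Lemma eq_seq_integrand n F G : (forall s, size s = n -> F s = G s) ->
  seq_integrand n F -> seq_integrand n G.
Proof.
move=> FG [mF [K [B [K0 B0 FK]]]]; split.
- move=> d X phi mphi; under eq_fun do rewrite -FG ?size_mkseq//; exact: mF.
- by exists K, B; split=> // s sn; rewrite -FG ?FK.
Qed.

Lemma insert_at0 t s : insert_at 0 t s = t :: s.
Proof. by rewrite /insert_at take0 drop0. Qed.

Lemma seq_integrand_cons n F t : seq_integrand n.+1 F ->
  seq_integrand n (fun s => F (t :: s)).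
Proof.
move=> /(seq_integrand_section t (leq0n n)).
by apply: eq_seq_integrand => s _; rewrite insert_at0.
Qed.

(** Induction on the number of inner variables: the first of them joins the prefix [p], at position
    [m], and is then integrated out by [int_at m]. *)
Lemma seq_integrand_iter_int m n F : seq_integrand (m + n) F ->
  seq_integrand m (fun p => iter_int n (fun s => F (p ++ s))).
Proof.
elim: n m => [|n IH] m nF.
  by rewrite addn0 in nF; apply: eq_seq_integrand nF => s _ /=; rewrite cats0.
rewrite addnS -addSn in nF.
apply: eq_seq_integrand (seq_integrand_int_at (leqnn m) (IH _ nF)) => p pm /=.
rewrite /int_at; apply: eq_Rintegral => t _; apply: eq_iter_int => s _.
by rewrite /insert_at -pm take_size drop_size -catA.
Qed.

Lemma integrable_iter_int n F : seq_integrand n.+1 F ->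
  mu.-integrable setT (EFin \o (fun t => iter_int n (fun s => F (t :: s)))).
Proof.
(* The case of a prefix of length 1. *)
rewrite -addn1 addnC => /seq_integrand_iter_int [mF [K [B [K0 B0 FK]]]].
apply: (@box_integrable _ K B).
  exact: (mF _ TR (fun _ t => t)).
by move=> t; have := FK [:: t] erefl; rewrite /= andbT.
Qed.

(** [iter_int] integrates the first coordinate outermost, [int_at i] integrates coordinate [i]
    innermost. For [i = 0], Fubini swaps the first two coordinates and induction carries the first
    past the rest; for [i > 0], the outermost coordinate is frozen and induction applies below
    it. *)
Lemma iter_int_at n F i : (i <= n)%N -> seq_integrand n.+1 F ->
  iter_int n.+1 F = iter_int n (int_at i F).
Proof.
elim: n F i => [|n IH] F [|i]// ni nF.
- pose H (p : R * R) := iter_int n (fun s => F ([:: p.1; p.2] ++ s)).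
  transitivity (Rintegral mu setT (fun t => Rintegral mu setT (fun u => H (t, u)))).
    by [].
  (* With all but two coordinates integrated out, the planar Fubini theorem suffices. *)
  have [mH [K [B [K0 B0 HK]]]] := @seq_integrand_iter_int 2 n F nF.
  rewrite (@fubini_box _ K B H); last 2 first.
  + apply: (mH _ (TR * TR)%type (fun k p => if k is 0%N then p.1 else p.2)) => -[|k].
      exact: measurable_fst.
    exact: measurable_snd.
  + by move=> p; have := HK [:: p.1; p.2] erefl; rewrite /= andbT.
  rewrite [RHS]/=; apply: eq_Rintegral => u _ /=.
  transitivity (iter_int n.+1 (fun s => F (insert_at 1 u s))).
    apply: eq_Rintegral => t _; apply: eq_iter_int => s _.
    by rewrite /insert_at /= take0 drop0.
  rewrite (IH _ 0%N)//; last exact: seq_integrand_section.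
  apply: eq_iter_int => s _; rewrite /int_at; apply: eq_Rintegral => t _.
  by rewrite !insert_at0 /insert_at /= take0 drop0.
- rewrite -[LHS]/(Rintegral mu setT (fun t => iter_int n.+1 (fun s => F (t :: s)))).
  apply: eq_Rintegral => t _.
  by rewrite (IH _ i)//; exact: seq_integrand_cons.
Qed.

Lemma iter_int_lin n c F G : seq_integrand n F -> seq_integrand n G ->
  iter_int n (fun s => c * F s + G s) = c * iter_int n F + iter_int n G.
Proof.
elim: n F G => [//|n IH] F G nF nG /=.
rewrite -RintegralZl//; last exact: integrable_iter_int.
rewrite -RintegralD//; last exact: integrable_iter_int.
  by apply: eq_Rintegral => t _; rewrite -IH//; exact: seq_integrand_cons.
by under [X in _.-integrable _ X]eq_fun do rewrite /= EFinM;
  apply: integrableZl => //; exact: integrable_iter_int.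
Qed.

Lemma iter_int_ge0 n F : (forall s, size s = n -> 0 <= F s) -> 0 <= iter_int n F.
Proof.
elim: n F => [|n IH] F F0 /=; first exact: F0.
by apply: Rintegral_ge0 => t _; apply: IH => s sn; apply: F0; rewrite /= sn.
Qed.

(** The cube of centre [l] and side [eta *+ 2] alone contributes [c] times its volume. The centre is
    a function on [nat] so that the induction can shift it. *)
Lemma iter_int_ge_cube n F (l : nat -> R) (eta c : R) : 0 <= eta -> seq_integrand n F ->
  (forall s, size s = n -> 0 <= F s) ->
  (forall s, size s = n -> (forall k, (k < n)%N -> `|nth 0 s k - l k| <= eta) ->
     c <= F s) ->
  c * (eta *+ 2) ^+ n <= iter_int n F.
Proof.
elim: n F l => [|n IH] F l eta0 nF F0 Fc.
  by rewrite expr0 mulr1 /=; exact: Fc.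
pose c' := c * (eta *+ 2) ^+ n.
have sub t : `|t - l 0%N| <= eta -> c' <= iter_int n (fun s => F (t :: s)).
  move=> tl; apply: (IH _ (fun k => l k.+1)) => //.
  - exact: seq_integrand_cons.
  - by move=> s sn; apply: F0; rewrite /= sn.
  - move=> s sn sl; apply: Fc; first by rewrite /= sn.
    by case => [|k] //= kn; exact: sl.
have pos t : 0 <= iter_int n (fun s => F (t :: s)).
  by apply: iter_int_ge0 => s sn; apply: F0; rewrite /= sn.
pose a := l 0%N - eta; pose b := l 0%N + eta.
have -> : c * (eta *+ 2) ^+ n.+1 =
    Rintegral mu setT (fun t => c' * \1_(`[a, b]%classic) t).
  rewrite RintegralZl//; last exact: integrable_indic_itv.
  rewrite /Rintegral integral_indic// setIT.
  have /= := lebesgue_measure_itv `[a, b] => ->; rewrite lte_fin.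
  rewrite exprSr mulrA; congr (_ * _).
  case: ltP => [_|ab]; first by rewrite -EFinB /= /a /b; ring.
  by rewrite /=; move: ab; rewrite /a /b; lra.
apply: le_Rintegral => //; last 2 first.
- exact: integrable_iter_int.
- move=> t _; rewrite indicE mem_setE in_itv/=.
  have [tab|_] := boolP (a <= t <= b); last by rewrite mulr0.
  by rewrite mulr1; apply: sub; rewrite ler_norml; move: tab; rewrite /a /b; lra.
- under [X in _.-integrable _ X]eq_fun do rewrite /= EFinM.
  by apply: integrableZl => //; exact: integrable_indic_itv.
Qed.

End IteratedIntegral.

(** * Integrals over row vectors, and volume-preserving shears *)

Section EuclideanIntegral.
Variables (R : realType) (d : nat).
Local Notation mu := (@lebesgue_measure R).
Local Notation TR := (measurableTypeR R).
Implicit Types (f g : 'rV[R]_d -> R) (x : 'rV[R]_d).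

Definition Rd_measurable f := forall disp (X : measurableType disp) (phi : X -> 'rV[R]_d),
  (forall k, measurable_fun setT ((fun w => phi w ord0 k) : X -> TR)) ->
  measurable_fun setT ((fun w => f (phi w)) : X -> TR).

Definition Rd_integrand f := Rd_measurable f /\
  exists K B : R, forall x, `|f x| <= K /\ (f x != 0 -> forall k, `|x ord0 k| <= B).

Definition row_of_seq (s : seq R) : 'rV[R]_d := \row_(i < d) nth 0 s i.

Lemma seq_integrand_row f : Rd_integrand f -> seq_integrand d (fun s => f (row_of_seq s)).
Proof.
move=> [mf [K [B fK]]]; split.
- move=> disp X phi mphi; apply: mf => k.
  by under eq_fun do rewrite mxE nth_mkseq//; exact: mphi.
- have K0 : 0 <= K by have [f0K _] := fK 0; exact: le_trans f0K.
  (* [box_bounded] wants a nonnegative radius, and [B] has no assumed sign. *)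
  exists K, `|B|; split => // s sn; have [fsK fsB] := fK (row_of_seq s).
  have [->|/fsB sB] := eqVneq (f (row_of_seq s)) 0; first by rewrite normr0 mulrn_wge0.
  suff -> : all (fun t => `|t| <= `|B|)%R s by [].
  apply/(all_nthP 0) => k ks; rewrite sn in ks.
  by have := sB (Ordinal ks); rewrite mxE /= => /le_trans; apply; exact: ler_norm.
Qed.

Lemma Rd_integrand_lin c f g : Rd_integrand f -> Rd_integrand g ->
  Rd_integrand (fun x => c * f x + g x).
Proof.
move=> [mf [K [B fK]]] [mg [L [C gL]]]; split.
  move=> disp X phi mphi; apply: measurable_funD; last exact: mg.
  by apply: measurable_funM => //; exact: mf.
exists (`|c| * K + L), (Num.max B C) => x; have [fxK fxB] := fK x; have [gxL gxC] := gL x.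
split; first by rewrite (le_trans (ler_normD _ _))// lerD// normrM ler_wpM2l.
move=> cfg k; rewrite le_max; have [f0|/fxB ->//] := eqVneq (f x) 0.
by rewrite gxC ?orbT//; move: cfg; rewrite f0 mulr0 add0r.
Qed.

Lemma integral_Rd_lin c f g : Rd_integrand f -> Rd_integrand g ->
  integral_Rd (fun x => c * f x + g x) = c * integral_Rd f + integral_Rd g.
Proof. by move=> nf ng; rewrite /integral_Rd iter_int_lin//; exact: seq_integrand_row. Qed.

Lemma Rd_integrand0 : Rd_integrand (fun=> 0).
Proof.
split; first by move=> disp X phi _; exact: measurable_cst.
by exists 0, 0 => x; rewrite normr0 eqxx.
Qed.

Lemma integral_Rd0 : integral_Rd (fun _ : 'rV[R]_d => 0) = 0.
Proof.
(* Linearity gives [I = I + I] for the integral [I] of zero. *)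
have := integral_Rd_lin 1 Rd_integrand0 Rd_integrand0; under eq_fun do rewrite mulr0 addr0.
by rewrite /=; lra.
Qed.

(** Both claims go together, since linearity at each step asks for integrability of the remaining
    sum. *)
Lemma integral_Rd_sum (I : Type) (r : seq I) (w : I -> R) (g : I -> 'rV[R]_d -> R) :
  (forall i, Rd_integrand (g i)) ->
  Rd_integrand (fun x => \sum_(i <- r) w i * g i x) /\
  integral_Rd (fun x => \sum_(i <- r) w i * g i x) =
    \sum_(i <- r) w i * integral_Rd (g i).
Proof.
move=> ng; elim: r => [|i r [nr intr]].
  under eq_fun do rewrite big_nil.
  by rewrite big_nil; split; [exact: Rd_integrand0|exact: integral_Rd0].
under eq_fun do rewrite big_cons.
by rewrite big_cons -intr integral_Rd_lin//; split => //; exact: Rd_integrand_lin.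
Qed.

Lemma integral_Rd_gt0 f (l : 'rV[R]_d) (eta c : R) :
  Rd_integrand f -> (forall x, 0 <= f x) ->
  0 < eta -> 0 < c -> (forall x, (forall k, `|x ord0 k - l ord0 k| <= eta) -> c <= f x) ->
  0 < integral_Rd f.
Proof.
move=> nf f0 eta0 c0 fc.
have : 0 < c * (eta *+ 2) ^+ d by rewrite mulr_gt0// exprn_gt0// mulrn_wgt0.
move=> /lt_le_trans; apply.
(* The centre is extended by 0 beyond index [d]. *)
apply: (@iter_int_ge_cube _ _ _ (fun k => if insub k is Some i then l ord0 i else 0)) => //.
- exact: ltW.
- exact: seq_integrand_row.
- move=> s sd sl; apply: fc => k; have := sl k (ltn_ord k).
  by rewrite mxE valK.
Qed.

(** For [i != j] this is a shear, with a flip of coordinate [i] when [eps = -1]; its determinant is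
    [eps]. *)
Definition coord_map (i j : 'I_d) (eps c : R) x : 'rV[R]_d :=
  \row_k (if k == i then eps * x ord0 i + c * x ord0 j else x ord0 k).

Lemma Rd_integrand_coord_map i j eps c f :
  i != j -> eps = 1 \/ eps = -1 -> Rd_integrand f ->
  Rd_integrand (fun x => f (coord_map i j eps c x)).
Proof.
move=> ij eps1 [mf [K [B fK]]]; split.
  move=> disp X phi mphi; apply: mf => k; under eq_fun do rewrite mxE.
  case: (k == i) => /=; last exact: mphi.
  by apply: measurable_funD; apply: measurable_funM => //; exact: mphi.
(* Coordinate [i] is recovered up to sign by subtracting [c * x_j], at a cost of at most
   [|c| * B]. *)
exists K, (B + `|c| * B) => x; have [? fB] := fK (coord_map i j eps c x).
split => // /fB xB.
have xkB k : k != i -> `|x ord0 k| <= B.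
  by move=> ki; have := xB k; rewrite mxE (negbTE ki).
have xjB : `|x ord0 j| <= B by apply: xkB; rewrite eq_sym.
have cB : 0 <= `|c| * B by rewrite mulr_ge0// (le_trans _ xjB).
move=> k; have [->|/xkB] := eqVneq k i; last by move=> /le_trans; apply; rewrite lerDl.
have := xB i; rewrite mxE eqxx => xiB.
have -> : `|x ord0 i| = `|eps * x ord0 i + c * x ord0 j - c * x ord0 j|.
  by rewrite addrK; case: eps1 => ->; rewrite ?mul1r ?mulN1r ?normrN.
by rewrite (le_trans (ler_normB _ _))// lerD// normrM ler_wpM2l.
Qed.

End EuclideanIntegral.

(** With coordinate [i] integrated innermost and the others fixed, the map is [t] to [eps * t] plus
    a constant. *)
Lemma integral_Rd_coord_map (R : realType) d (i j : 'I_d) (eps c : R) f :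
  i != j -> eps = 1 \/ eps = -1 -> Rd_integrand f ->
  integral_Rd (fun x => f (coord_map i j eps c x)) = integral_Rd f.
Proof.
case: d i j f => [[]//|n] i j f ij eps1 nf.
have in1 : (i <= n)%N by rewrite -ltnS.
have nfT := Rd_integrand_coord_map c ij eps1 nf.
rewrite /integral_Rd (iter_int_at in1 (seq_integrand_row nfT)).
rewrite (iter_int_at in1 (seq_integrand_row nf)).
apply: eq_iter_int => s sn; rewrite /int_at.
have [mg [K [B [_ _ gK]]]] := seq_integrand_line in1 sn (seq_integrand_row nf).
(* Among the remaining coordinates [s], the former index [j] sits at [unbump i j]. *)
rewrite -(Rintegral_affine_var (c * nth 0 s (unbump i j)) eps1 mg gK).
apply: eq_Rintegral => t _; congr f; apply/rowP => k; rewrite !mxE.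
rewrite !nth_insert_at ?sn// eqxx.
have -> : (j == i :> nat) = false by rewrite eq_sym; exact: negbTE ij.
by rewrite -[k == i]/(k == i :> nat); case: (k == i :> nat).
Qed.

(** * Orthogonal reflections acting on two coordinates *)

Section PlaneReflection.
Variables (R : realType) (d : nat) (i j : 'I_d) (r : R).
Hypothesis ij : i != j.
Implicit Types (x a : 'rV[R]_d) (f : 'rV[R]_d -> R).

(** For [r = tan t] these two quantities are [cos (2 t)] and [sin (2 t)]. *)
Definition refl_cos : R := (1 - r ^+ 2) / (1 + r ^+ 2).
Definition refl_sin : R := 2 * r / (1 + r ^+ 2).

(* Orthogonal reflection of the plane of the coordinates [i] and [j] fixing [(1, r)]. *)
Definition plane_refl x : 'rV[R]_d :=
  \row_k (if k == i then refl_cos * x ord0 i + refl_sin * x ord0 j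
          else if k == j then refl_sin * x ord0 i - refl_cos * x ord0 j
          else x ord0 k).

Lemma refl_den : 1 + r ^+ 2 != 0.
Proof. by rewrite gt_eqF// ltr_pwDl// sqr_ge0. Qed.

(** The factorisation of a rotation into three shears, with a sign flip in the middle factor that
    turns it into a reflection. *)
Lemma plane_reflE x : plane_refl x =
  coord_map i j 1 (- r) (coord_map j i (-1) refl_sin (coord_map i j 1 r x)).
Proof.
have den := refl_den; have ji : (j == i) = false by rewrite eq_sym (negbTE ij).
apply/rowP => k; rewrite !mxE !eqxx ji (negbTE ij) /refl_cos /refl_sin.
case: (k == i); first by field.
by case: (k == j) => //; field.
Qed.

Lemma integral_Rd_plane_refl f : Rd_integrand f ->
  integral_Rd (fun x => f (plane_refl x)) = integral_Rd f.
Proof.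
move=> nf; have ji : j != i by rewrite eq_sym.
under eq_fun do rewrite plane_reflE.
have n3 := Rd_integrand_coord_map (- r) ij (or_introl erefl) nf.
have n2 := Rd_integrand_coord_map refl_sin ji (or_intror erefl) n3.
rewrite (integral_Rd_coord_map r ij (or_introl erefl) n2).
rewrite (integral_Rd_coord_map refl_sin ji (or_intror erefl) n3).
exact: (integral_Rd_coord_map (- r) ij (or_introl erefl) nf).
Qed.

Lemma dotp_plane a x : dotp a x =
  a ord0 i * x ord0 i + (a ord0 j * x ord0 j +
   \sum_(k | (k != i) && (k != j)) a ord0 k * x ord0 k).
Proof.
by rewrite /dotp (bigD1 i)//= (bigD1 j)//= eq_sym.
Qed.

(** The reflection is self-adjoint, and it fixes [a], whose part in the plane is a multiple of
    [(1, r)]. *)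
Lemma dotp_plane_refl a x : a ord0 j = r * a ord0 i ->
  dotp a (plane_refl x) = dotp a x.
Proof.
have den := refl_den; have ji : (j == i) = false by rewrite eq_sym (negbTE ij).
move=> aj; rewrite !dotp_plane aj; rewrite !mxE !eqxx ji addrA [RHS]addrA; congr (_ + _).
  by rewrite /refl_cos /refl_sin; field.
by apply: eq_bigr => k /andP[/negbTE ki /negbTE kj]; rewrite mxE ki kj.
Qed.

Lemma enorm_plane_refl x : enorm (plane_refl x) = enorm x.
Proof.
have den := refl_den; have ji : (j == i) = false by rewrite eq_sym (negbTE ij).
congr Num.sqrt; rewrite !dotp_plane !mxE !eqxx ji addrA [RHS]addrA; congr (_ + _).
  by rewrite /refl_cos /refl_sin; field.
by apply: eq_bigr => k /andP[/negbTE ki /negbTE kj]; rewrite mxE ki kj.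
Qed.

(** The vector [(- r, 1)] is normal to the mirror line. *)
Lemma plane_refl_anti x :
  plane_refl x ord0 j - r * plane_refl x ord0 i = - (x ord0 j - r * x ord0 i).
Proof.
have den := refl_den; have ji : (j == i) = false by rewrite eq_sym (negbTE ij).
by rewrite !mxE !eqxx ji /refl_cos /refl_sin; field.
Qed.

End PlaneReflection.

(** * Euclidean norm, measurability, and integrands on the unit ball *)

Section Euclid.
Variables (R : realType) (d : nat).
Local Notation TR := (measurableTypeR R).
Implicit Types (x a : 'rV[R]_d).

Lemma dotp_ge0 x : 0 <= dotp x x.
Proof. by apply: sumr_ge0 => k _; rewrite -expr2 sqr_ge0. Qed.

Lemma dotp_gt0 x : x != 0 -> 0 < dotp x x.
Proof.
move=> x0; rewrite lt_def dotp_ge0 andbT; apply: contra_neq x0 => /eqP.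
rewrite psumr_eq0; last by move=> k _; rewrite -expr2 sqr_ge0.
move=> /allP xk; apply/rowP => k; apply/eqP; rewrite mxE.
by have := xk k (mem_index_enum _); rewrite /= mulf_eq0 orbb.
Qed.

Lemma dotpZr c a x : dotp a (c *: x) = c * dotp a x.
Proof. by rewrite /dotp mulr_sumr; apply: eq_bigr => k _; rewrite mxE mulrCA. Qed.

Lemma dotpZl c a x : dotp (c *: a) x = c * dotp a x.
Proof. by rewrite /dotp mulr_sumr; apply: eq_bigr => k _; rewrite mxE mulrA. Qed.

Lemma dotpDr a x y : dotp a (x + y) = dotp a x + dotp a y.
Proof. by rewrite /dotp -big_split; apply: eq_bigr => k _; rewrite mxE mulrDr. Qed.

Lemma coord_le_enorm x k : `|x ord0 k| <= enorm x.
Proof.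
rewrite -sqrtr_sqr ler_wsqrtr// /dotp (bigD1 k)//= -expr2 lerDl.
by apply: sumr_ge0 => l _; rewrite -expr2 sqr_ge0.
Qed.

Lemma measurable_dotp disp (X : measurableType disp) (a : 'rV[R]_d)
  (phi : X -> 'rV[R]_d) :
  (forall k, measurable_fun setT ((fun w => phi w ord0 k) : X -> TR)) ->
  measurable_fun setT ((fun w => dotp a (phi w)) : X -> TR).
Proof.
move=> mphi; apply: measurable_sum => k.
by apply: measurable_funM => //; exact: mphi.
Qed.

Lemma measurable_enorm : Rd_measurable (@enorm R d).
Proof.
move=> disp X phi mphi; rewrite /enorm.
under eq_fun do rewrite -powR12_sqrt ?dotp_ge0//.
apply: (measurableT_comp (measurable_powR _)).
apply: measurable_sum => k; apply: measurable_funM; exact: mphi.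
Qed.

Lemma measurable_unit_ball_ind : Rd_measurable (@unit_ball_ind R d).
Proof.
move=> disp X phi mphi; rewrite /unit_ball_ind.
apply: measurable_fun_ifT => //; apply: measurable_and.
  by apply: measurable_fun_ltr => //; exact: measurable_enorm.
by apply: measurable_fun_ler => //; exact: measurable_enorm.
Qed.

Lemma Rd_integrand_ball (h : 'rV[R]_d -> R) K :
  Rd_measurable h -> (forall x, `|h x| <= K) ->
  Rd_integrand (fun x => unit_ball_ind x * h x).
Proof.
move=> mh hK; split.
  move=> disp X phi mphi; apply: measurable_funM; last exact: mh.
  exact: measurable_unit_ball_ind.
exists K, 1 => x; rewrite /unit_ball_ind; case: ifPn => [/andP[_ x1]|_].
  by rewrite mul1r; split=> // _ k; exact: le_trans (coord_le_enorm _ _) x1.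
by rewrite mul0r normr0 eqxx; split => //; exact: le_trans (normr_ge0 (h 0)) _.
Qed.

End Euclid.

(** A small cube around the point of norm [1 / 2] in the direction opposite to [a]. It witnesses
    positive volume, both for the ball and for the cap where the label is [-1]. *)
Lemma cone_cube (R : realType) (d : nat) (a : 'rV[R]_d) : (0 < d)%N -> a != 0 ->
  exists (l : 'rV[R]_d) (eta : R), 0 < eta /\
  forall x : 'rV[R]_d, (forall k, `|x ord0 k - l ord0 k| <= eta) ->
    [/\ 0 < enorm x, enorm x <= 1 & dotp a x <= - (enorm a / 4)].
Proof.
move=> d0 a0; have D0 := dotp_gt0 a0.
have n0 : 0 < enorm a by rewrite sqrtr_gt0.
have n2 : enorm a ^+ 2 = dotp a a by rewrite sqr_sqrtr// ltW.
pose s := \sum_(k < d) `|a ord0 k|.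
have s0 : 0 <= s by exact: sumr_ge0.
have dR : 1 <= d%:R :> R by rewrite ler1n.
have dR0 : 0 < d%:R :> R by exact: lt_le_trans dR.
have s1 : 0 < 4 * (s + 1) by rewrite mulr_gt0// ltr_wpDl.
pose l := - (2 * enorm a)^-1 *: a.
(* The first bound gives [d * eta ^+ 2 <= 1 / 4], which keeps the cube in the ball; the second
   limits the change of [dotp a x] over the cube to [enorm a / 4], as [s] is the 1-norm of [a]. *)
pose eta := Num.min (2 * d%:R)^-1 (enorm a / (4 * (s + 1))).
have eta0 : 0 < eta.
  by rewrite lt_min invr_gt0 mulr_gt0//= divr_gt0.
have eta_d : d%:R * eta ^+ 2 <= 1 / 4.
  have e1 : eta <= (2 * d%:R)^-1 by rewrite ge_min lexx.
  have : eta ^+ 2 <= (2 * d%:R)^-1 ^+ 2.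
    by rewrite ler_pXn2r// nnegrE; [exact: ltW|exact: le_trans (ltW eta0) e1].
  move=> /(ler_wpM2l (ler0n R d))/le_trans; apply.
  have -> : d%:R * (2 * d%:R)^-1 ^+ 2 = (4 * d%:R)^-1 :> R.
    by field; rewrite gt_eqF.
  by rewrite mul1r lef_pV2 ?posrE ?mulr_gt0//; lra.
have eta_s : eta * s <= enorm a / 4.
  have e1 : eta <= enorm a / (4 * (s + 1)) by rewrite ge_min lexx orbT.
  rewrite ler_pdivlMr// in e1.
  have : 0 < eta by []. nra.
exists l, eta; split => // x xl.
have al : dotp a l = - (enorm a / 2).
  by rewrite /l dotpZr -n2; field; rewrite gt_eqF.
have ll : dotp l l = 1 / 4.
  by rewrite {1}/l dotpZl al; field; rewrite gt_eqF.
have ax : dotp a x <= - (enorm a / 4).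
  have -> : x = l + (x - l) by rewrite addrC subrK.
  rewrite dotpDr al.
  have : dotp a (x - l) <= eta * s.
    rewrite /s mulr_sumr; apply: ler_sum => k _; rewrite !mxE.
    rewrite (le_trans (ler_norm _))// normrM mulrC ler_wpM2r//.
    by have := xl k; rewrite mxE.
  lra.
have xx : dotp x x <= 1.
  (* Coordinatewise, [u^2 <= 2 v^2 + 2 (u - v)^2], which amounts to [(u - 2 v)^2 >= 0]. *)
  apply: (@le_trans _ _ (2 * dotp l l + 2 * (d%:R * eta ^+ 2))); last lra.
  have -> : d%:R * eta ^+ 2 = \sum_(k < d) eta ^+ 2.
    by rewrite sumr_const card_ord mulr_natl.
  rewrite /dotp !mulr_sumr -big_split; apply: ler_sum => k _ /=.
  have := xl k; set u := x ord0 k; set v := l ord0 k; rewrite ler_norml => /andP[u1 u2].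
  have : (u - v) ^+ 2 <= eta ^+ 2 by nra.
  have : 0 <= (u - 2 * v) ^+ 2 by exact: sqr_ge0.
  nra.
split => //.
- rewrite sqrtr_gt0 dotp_gt0//; apply: contraTneq ax => ->.
  rewrite -ltNge -[0 : 'rV_d](scale0r 0) dotpZr mul0r; lra.
- by rewrite -sqrtr1 ler_wsqrtr.
Qed.

(** * The expected estimator as a cone integral, and its direction *)

Section GradientEstimator.
Variables (R : realType) (d : nat) (M : 'rV[R]_d -> R) (a z : 'rV[R]_d) (b rho : R).
Hypothesis ME : forall x, M x = dotp a x + b.
Implicit Types (x : 'rV[R]_d).

Definition label x : R := Phi M (z + rho *: ((enorm x)^-1 *: x)).

Definition cone_integrand (k : 'I_d) x : R :=
  unit_ball_ind x * (label x * ((enorm x)^-1 *: x) ord0 k).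

(** The label depends on [x] only through [enorm x] and [dotp a x], both kept by the reflections
    above. *)
Lemma labelE x : label x =
  if 0 < M z + rho * ((enorm x)^-1 * dotp a x) then 0 else -1.
Proof.
rewrite /label /Phi /sgn !ME dotpDr !dotpZr addrAC.
by case: ifP => _; lra.
Qed.

Lemma cone_integrandE k x : cone_integrand k x =
  unit_ball_ind x * (label x * ((enorm x)^-1 * x ord0 k)).
Proof. by rewrite /cone_integrand mxE. Qed.

Lemma Rd_integrand_cone_integrand k : Rd_integrand (cone_integrand k).
Proof.
apply: (@Rd_integrand_ball _ _ (fun x => label x * ((enorm x)^-1 *: x) ord0 k) 1).
- move=> disp X phi mphi; under eq_fun do rewrite labelE mxE.
  have mV : measurable_fun setT ((fun w => (enorm (phi w))^-1) : X -> measurableTypeR R).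
    under eq_fun do rewrite -powR_inv1 ?sqrtr_ge0//.
    apply: (measurableT_comp (measurable_powR _)); exact: measurable_enorm.
  apply: measurable_funM; last by apply: measurable_funM => //; exact: mphi.
  apply: measurable_fun_ifT => //; apply: measurable_fun_ltr => //.
  apply: measurable_funD => //; apply: measurable_funM => //.
  by apply: measurable_funM => //; exact: measurable_dotp.
- move=> x; rewrite labelE normrM mulr_ile1//.
    by case: ifP => _; rewrite ?normr0 ?normrN1.
  rewrite mxE normrM normfV (ger0_norm (sqrtr_ge0 _ : 0 <= enorm x)).
  (* At norm 0 the inverse is 0 by convention, so the bound still holds. *)
  have [->|n0] := eqVneq (enorm x) 0; first by rewrite invr0 mul0r.
  by rewrite ler_pdivrMl ?mulr1 ?coord_le_enorm// lt_def n0 sqrtr_ge0.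
Qed.

(* The integrand of [E_j - r E_i] changes sign under the reflection of the
   (i, j)-plane that fixes [a]. *)
Lemma integral_cone_integrand_prop (i j : 'I_d) r : i != j -> a ord0 j = r * a ord0 i ->
  integral_Rd (cone_integrand j) = r * integral_Rd (cone_integrand i).
Proof.
move=> ij aj.
pose G x := - r * cone_integrand i x + cone_integrand j x.
have nG : Rd_integrand G by apply: Rd_integrand_lin; exact: Rd_integrand_cone_integrand.
have GE : integral_Rd G =
    - r * integral_Rd (cone_integrand i) + integral_Rd (cone_integrand j).
  by apply: integral_Rd_lin; exact: Rd_integrand_cone_integrand.
have anti x : G (plane_refl i j r x) = -1 * G x + 0.
  rewrite /G !cone_integrandE !labelE /unit_ball_ind enorm_plane_refl// dotp_plane_refl//.
  set c := if _ then 1 else 0; set w := if _ then 0 else _.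
  have := plane_refl_anti r ij x.
  move: (plane_refl i j r x ord0 i) (plane_refl i j r x ord0 j) => v u uv.
  have -> : u = r * v - (x ord0 j - r * x ord0 i) by rewrite -uv; ring.
  ring.
have := integral_Rd_plane_refl r ij nG.
under eq_fun do rewrite anti.
rewrite integral_Rd_lin//; last exact: Rd_integrand0.
rewrite integral_Rd0 GE; lra.
Qed.

Lemma dotp_cone_integrand x : \sum_(k < d) a ord0 k * cone_integrand k x =
  unit_ball_ind x * (label x * ((enorm x)^-1 * dotp a x)).
Proof.
rewrite /dotp !mulr_sumr; apply: eq_bigr => k _.
by rewrite cone_integrandE; ring.
Qed.

Lemma expected_grad_estE delta rad k : delta * rad = rho ->
  expected_grad_est M z delta rad ord0 k =
  integral_Rd (cone_integrand k) / integral_Rd (@unit_ball_ind R d).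
Proof. by rewrite /expected_grad_est /sphere_expect_vec mxE => ->. Qed.

End GradientEstimator.

(** * Positivity of the integrals, and the cosine for large radii *)

Lemma integral_unit_ball_gt0 (R : realType) (d : nat) (a : 'rV[R]_d) :
  (0 < d)%N -> a != 0 ->
  0 < integral_Rd (@unit_ball_ind R d).
Proof.
move=> d0 a0; have [l [eta [eta0 cube]]] := cone_cube d0 a0.
have nB : Rd_integrand (fun x : 'rV[R]_d => unit_ball_ind x * 1).
  apply: (@Rd_integrand_ball _ _ (fun=> 1) 1) => [disp X phi _|x].
    exact: measurable_cst.
  by rewrite normr1.
have -> : @unit_ball_ind R d = (fun x => unit_ball_ind x * 1).
  by apply/funext => x; rewrite mulr1.
apply: (integral_Rd_gt0 (c := 1) nB _ eta0) => //.
- by move=> x; rewrite mulr1 /unit_ball_ind; case: ifP.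
- by move=> x /cube[x0 x1 _]; rewrite mulr1 /unit_ball_ind x0 x1.
Qed.

(** The sum is the integral of the pairing with [a]. A label [-1] forces [dotp a x < 0] because
    [M z > 0], so the integrand is nonnegative; the threshold on [rho] makes the label [-1] on the
    whole cube. *)
Lemma integral_cone_integrand_gt0 (R : realType) (d : nat)
  (M : 'rV[R]_d -> R) (a z : 'rV[R]_d) (b rho : R) :
  (forall x, M x = dotp a x + b) -> (0 < d)%N -> a != 0 -> 0 < M z ->
  4 * M z / enorm a <= rho ->
  0 < \sum_(k < d) a ord0 k * integral_Rd (cone_integrand M z rho k).
Proof.
move=> ME d0 a0 Mz rhoM; have [l [eta [eta0 cube]]] := cone_cube d0 a0.
have n0 : 0 < enorm a by rewrite sqrtr_gt0 dotp_gt0.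
have rho0 : 0 < rho by apply: lt_le_trans rhoM; rewrite divr_gt0// mulr_gt0.
have [nP <-] := integral_Rd_sum (index_enum 'I_d) (fun k => a ord0 k)
  (fun k => Rd_integrand_cone_integrand z rho ME k).
apply: (integral_Rd_gt0 (c := enorm a / 4) nP _ eta0).
- move=> x; rewrite dotp_cone_integrand (labelE z rho ME) /unit_ball_ind.
  case: ifP => _; last by rewrite mul0r.
  case: ltP => t; first by rewrite mul0r mulr0.
  by set u := _ * dotp a x in t *; nra.
- by rewrite divr_gt0.
- move=> x /cube[x0 x1 ax].
  rewrite dotp_cone_integrand (labelE z rho ME) /unit_ball_ind x0 x1 mul1r.
  (* Normalising a vector of norm at most 1 only lowers a negative pairing. *)
  have : (enorm x)^-1 * dotp a x <= - (enorm a / 4).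
    rewrite ler_pdivrMl//; nra.
  set u := _ * dotp a x => u0.
  rewrite ler_pdivrMr// in rhoM.
  rewrite ifF; first lra.
  by apply/negbTE; rewrite -leNgt; nra.
Qed.

Lemma cos_angle_pos_scale (R : realType) (d : nat) (a : 'rV[R]_d) (c : R) :
  a != 0 -> 0 < c -> cos_angle (c *: a) a = 1.
Proof.
move=> a0 c0; have D0 := dotp_gt0 a0.
have n2 : enorm a ^+ 2 = dotp a a by rewrite sqr_sqrtr// ltW.
have e : enorm (c *: a) = c * enorm a.
  by rewrite /enorm dotpZl dotpZr mulrA -expr2 sqrtrM ?sqr_ge0// sqrtr_sqr gtr0_norm.
by rewrite /cos_angle e dotpZl -n2; field; rewrite !gt_eqF ?sqrtr_gt0.
Qed.

Theorem theorem1 (R : realType) (d : nat) (M : 'rV[R]_d -> R)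
    (a : 'rV[R]_d) (b : R) (z : 'rV[R]_d) (delta : R) :
  (2 <= d)%N ->
  (forall x, M x = dotp a x + b) ->  (* M affine, with gradient a = grad M (z) *)
  a != 0 ->
  0 < M z ->
  0 < delta < 1 ->
  (exists C : R, \forall rad \near +oo,
      1 - C * (M z ^+ 2 * (d.-1)%:R ^+ 2 / (delta ^+ 2 * rad ^+ 2 * enorm a ^+ 2))
        <= cos_angle (expected_grad_est M z delta rad) a)
  /\ (fun rad => cos_angle (expected_grad_est M z delta rad) a) @ +oo --> (1 : R).
Proof.
move=> d2 ME a0 Mz /andP[delta0 _]; have d0 : (0 < d)%N by exact: leq_trans d2.
have n0 : 0 < enorm a by rewrite sqrtr_gt0 dotp_gt0.
have V0 := integral_unit_ball_gt0 d0 a0.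
have cos_large rho rad : delta * rad = rho -> 4 * M z / enorm a <= rho ->
    cos_angle (expected_grad_est M z delta rad) a = 1.
  move=> rhoE rhoM.
  (* A nonzero coordinate of [a] serves as reference: comparing every other one with it shows that
     the integrals are proportional to [a]. *)
  have [i ai] : exists i, a ord0 i != 0.
    apply/existsP; apply: contraNT a0; rewrite negb_exists => /forallP a0.
    by apply/eqP/rowP => k; rewrite mxE; apply/eqP; rewrite -[_ == _]negbK.
  pose c := integral_Rd (cone_integrand M z rho i) / a ord0 i.
  have Ic k : integral_Rd (cone_integrand M z rho k) = c * a ord0 k.
    have [->|ki] := eqVneq k i; first by rewrite divfK.
    rewrite (@integral_cone_integrand_prop _ _ M a z b rho ME i k (a ord0 k / a ord0 i)).
    - by rewrite /c; ring.
    - by rewrite eq_sym.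
    - by rewrite divfK.
  (* The positive pairing equals [c * dotp a a]. *)
  have c0 : 0 < c.
    have := integral_cone_integrand_gt0 ME d0 a0 Mz rhoM.
    under eq_bigr do rewrite Ic mulrCA.
    by rewrite -mulr_sumr pmulr_lgt0// dotp_gt0.
  have -> : expected_grad_est M z delta rad = (c / integral_Rd (@unit_ball_ind R d)) *: a.
    apply/rowP => k; rewrite (@expected_grad_estE _ _ _ _ rho)// Ic mxE; ring.
  by apply: cos_angle_pos_scale => //; rewrite divr_gt0.
have cos1 : \forall rad \near +oo, cos_angle (expected_grad_est M z delta rad) a = 1.
  apply: filterS (nbhs_pinfty_ge (num_real (delta^-1 * (4 * M z / enorm a)))) => rad.
  by rewrite ler_pdivrMl// => /(cos_large _ _ erefl).
split.
(* The cosine is eventually equal to 1, so a zero constant suffices. *)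
- by exists 0; apply: filterS cos1 => rad ->; rewrite mul0r subr0.
- apply/cvgrPdist_lt => e e0; apply: filterS cos1 => rad ->.
  by rewrite subrr normr0.
Qed.
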